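(* Let $s\in[0,1]$ and let $(L_n)_{n\ge1}$, $(U_n)_{n\ge1}$ be random variables on a common probability space; set $L_0:\equiv0$, $U_0:\equiv1$. Let $\mathcal{F}_0=\{\emptyset,\Omega\}$, $\mathcal{F}_n=\sigma\{L_n,U_n\}$ for $n\ge1$, and $\mathcal{F}_{k,\infty}=\sigma\{\mathcal{F}_k,\mathcal{F}_{k+1},\dots\}$. Assume that almost surely for every $n\ge1$: $L_n\le U_n$, $L_n\in[0,1]$, $U_n\in[0,1]$; that $l_n:=\mathbb{E}L_n$ is nondecreasing with $l_n\to s$ and $u_n:=\mathbb{E}U_n$ is nonincreasing with $u_n\to s$; and that for every $n\ge1$, almost surely, $$\mathbb{E}(L_{n-1}\mid\mathcal{F}_{n,\infty})=\mathbb{E}(L_{n-1}\mid\mathcal{F}_n)\le L_n,\qquad \mathbb{E}(U_{n-1}\mid\mathcal{F}_{n,\infty})=\mathbb{E}(U_{n-1}\mid\mathcal{F}_n)\ge U_n .$$ Put $L_n^*:=\mathbb{E}(L_{n-1}\mid\mathcal{F}_n)$, $U_n^*:=\mathbb{E}(U_{n-1}\mid\mathcal{F}_n)$ and assume $U_n^*>L_n^*$ a.s. for every $n\ge1$ (so the following recursion is well defined). Define $\tilde L_0:=0$, $\tilde U_0:=1$ and for $n\ge1$ $$\tilde L_n=\tilde L_{n-1}+\frac{L_n-L_n^*}{U_n^*-L_n^*}\,(\tilde U_{n-1}-\tilde L_{n-1}),\qquad \tilde U_n=\tilde U_{n-1}-\frac{U_n^*-U_n}{U_n^*-L_n^*}\,(\tilde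 U_{n-1}-\tilde L_{n-1}).$$ Let $G_0\sim U(0,1)$ be independent of $(L_n,U_n)_{n\ge1}$, let $N:=\inf\{n\ge1:\ G_0\le\tilde L_n\ \text{or}\ G_0>\tilde U_n\}$, and let $C_s:=1$ if $G_0\le\tilde L_N$ and $C_s:=0$ otherwise. Then $N<\infty$ a.s., $\mathbb{P}(C_s=1)=s$, and $\mathbb{P}(N>n)=u_n-l_n$ for every $n\ge1$.
   Context: This formalizes ''Algorithm 4'': $L_n$ is a reverse-time supermartingale and $U_n$ a reverse-time submartingale with respect to $(\mathcal{F}_{n,\infty})$, and monotone sequences $\tilde L_n,\tilde U_n$ are built online from them and then used as in the scheme ''output $1$ if $G_0\le\tilde L_n$, $0$ if $G_0>\tilde U_n$, else continue''. *)

(* Defs.v *)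
From HB Require Import structures.
From mathcomp Require Import all_boot all_order all_algebra.
From mathcomp Require Import all_classical all_reals all_analysis.
Set Implicit Arguments. Unset Strict Implicit. Unset Printing Implicit Defensive.
Import Order.TTheory GRing.Theory Num.Theory.
Local Open Scope classical_set_scope.
Local Open Scope ring_scope.

Section Defs.
Context {d : measure_display} {T : measurableType d} {R : realType}.

Definition sigma2 (X Y : T -> R) : set (set T) :=
  <<s [set A | exists B : set R, measurable B /\ A = X @^-1` B] `|`
      [set A | exists B : set R, measurable B /\ A = Y @^-1` B] >>.

Definition Fn (L U : nat -> T -> R) (n : nat) : set (set T) :=
  if n is 0 then [set set0; setT] else sigma2 (L n) (U n).

Definition Finf (L U : nat -> T -> R) (k : nat) : set (set T) :=
  <<s \bigcup_(j in [set j | (k <= j)%N]) Fn L U j >>.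

Definition G_measurable (G : set (set T)) (Y : T -> R) : Prop :=
  forall B : set R, measurable B -> G (Y @^-1` B).

Definition is_cond_exp (P : probability T R) (G : set (set T)) (X Y : T -> R)
  : Prop :=
  [/\ G_measurable G Y, P.-integrable setT (EFin \o Y) &
      forall A, G A ->
        (\int[P]_(x in A) (Y x)%:E = \int[P]_(x in A) (X x)%:E)%E].

Fixpoint tLU (L U Ls Us : nat -> T -> R) (n : nat) (t : T) : R * R :=
  match n with
  | 0 => (0, 1)
  | n'.+1 =>
      let a := (tLU L U Ls Us n' t).1 in
      let b := (tLU L U Ls Us n' t).2 in
      let den := Us n t - Ls n t in
      (a + (L n t - Ls n t) / den * (b - a),
       b - (Us n t - U n t) / den * (b - a))
  end.

Definition tL L U Ls Us n t := (tLU L U Ls Us n t).1.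
Definition tU L U Ls Us n t := (tLU L U Ls Us n t).2.

Definition stop_cond L U Ls Us (G0 : T -> R) (n : nat) (t : T) : Prop :=
  G0 t <= tL L U Ls Us n t \/ tU L U Ls Us n t < G0 t.

Definition N_eq L U Ls Us G0 (n : nat) (t : T) : Prop :=
  [/\ (1 <= n)%N, stop_cond L U Ls Us G0 n t &
      forall m, (1 <= m)%N -> (m < n)%N -> ~ stop_cond L U Ls Us G0 m t].

Definition N_gt L U Ls Us G0 (n : nat) (t : T) : Prop :=
  forall m, (1 <= m)%N -> (m <= n)%N -> ~ stop_cond L U Ls Us G0 m t.

Definition N_finite L U Ls Us G0 (t : T) : Prop :=
  exists n, N_eq L U Ls Us G0 n t.

(* C_s(t) = 1, i.e. G0 <= L~_N  (C_s = 0 otherwise, including N = oo) *)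
Definition Cs_one L U Ls Us (G0 : T -> R) (t : T) : Prop :=
  exists n, N_eq L U Ls Us G0 n t /\ G0 t <= tL L U Ls Us n t.

End Defs.

(* Main.v *)
Require Import Defs.
From HB Require Import structures.
From mathcomp Require Import all_boot all_order all_algebra.
From mathcomp Require Import all_classical all_reals all_analysis.
From mathcomp Require Import measurable_realfun ring.
Import Order.TTheory GRing.Theory Num.Theory.
Local Open Scope classical_set_scope.
Local Open Scope ring_scope.

(* By induction on n, E(tL_n | F_(n,oo)) = L_n and E(tU_n | F_(n,oo)) = U_n: the
   increments of tL and tU are multiples of the previous width tU - tL by
   factors measurable with respect to F_n, and the conditional expectation of
   that width is exactly the denominator Us_n - Ls_n.
   Hence E tL_n = l_n and E tU_n = u_n. Almost surely tL_n increases, tU_n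
   decreases and tL_m <= tU_n for all m, n, so up to a null set
     {N > n} = {tL_n < G0 <= tU_n}  and
     {G0 <= tL_n} is contained in {C_s = 1}, itself contained in {G0 <= tU_n}.
   Since G0 is uniform and independent of tL_n and tU_n, the probabilities of
   {tL_n < G0 <= tU_n}, {G0 <= tL_n} and {G0 <= tU_n} are u_n - l_n, l_n and u_n;
   now let n tend to infinity. *)

(** * Measurability and almost-everywhere comparison *)

(** Real powers are measurable, and squaring provides the nonnegative base on which the power -1 is
    the inverse. The factorisation survives at zeros of [f] since [0^-1 = 0]. *)
Lemma measurable_funV (d : measure_display) (T : measurableType d)
  (R : realType) (D : set T) (f : T -> R) :
  measurable_fun D f -> measurable_fun D (fun t => (f t)^-1).
Proof.
move=> mf.
have -> : (fun t => (f t)^-1) = (fun t => f t * powR (f t ^+ 2) (-1)).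
  apply/funext => t; rewrite powR_inv1 ?sqr_ge0//.
  by have [->|f0] := eqVneq (f t) 0; rewrite ?invr0 ?mul0r// expr2 invfM mulVKf.
apply: measurable_funM => //.
exact: (measurableT_comp (measurable_powR (-1)) (measurable_funX 2 mf)).
Qed.

Lemma measurable_set_ler (d : measure_display) (T : measurableType d)
  (R : realType) (f g : T -> R) :
  measurable_fun setT f -> measurable_fun setT g ->
  measurable [set t | f t <= g t].
Proof.
move=> mf mg; rewrite -[X in measurable X]setTI.
have mfg := measurable_fun_ler mf mg.
exact: (mfg measurableT [set true]).
Qed.

(** Integrating indicators turns the claim into monotonicity of the integral, which already
    tolerates an exceptional null set. *)
Lemma le_measure_ae (d : measure_display) (T : measurableType d)
  (R : realType) (P : {measure set T -> \bar R}) (A B : set T) :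
  measurable A -> measurable B -> {ae P, forall t, A t -> B t} ->
  (P A <= P B)%E.
Proof.
move=> mA mB AB; rewrite -(setIT A) -(setIT B) -!integral_indic//.
apply: ae_ge0_le_integral => //.
- exact/measurable_EFinP/measurable_indic.
- exact/measurable_EFinP/measurable_indic.
apply: filterS AB => t AB _; rewrite lee_fin !indicE.
by case: (asboolP (A t)) => [/[dup] At /AB Bt|nA];
  [rewrite !mem_set|rewrite memNset].
Qed.

Lemma ae_eq_integral_EFin (d : measure_display) (T : measurableType d)
  (R : realType) (P : {measure set T -> \bar R}) (f g : T -> R) (A : set T) :
  measurable A -> measurable_fun setT f -> measurable_fun setT g ->
  {ae P, forall t, f t = g t} ->
  (\int[P]_(t in A) (f t)%:E = \int[P]_(t in A) (g t)%:E)%E.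
Proof.
move=> mA mf mg fg; apply: ae_eq_integral => //.
- exact/measurable_EFinP/measurable_funTS.
- exact/measurable_EFinP/measurable_funTS.
- by apply: filterS fg => t fgt _; rewrite fgt.
Qed.

Lemma ae_bounded_integrable (d : measure_display) (T : measurableType d)
  (R : realType) (P : probability T R) (f : T -> R) (M : R) (D : set T) :
  measurable D -> measurable_fun setT f -> {ae P, forall t, `|f t| <= M} ->
  P.-integrable D (EFin \o f).
Proof.
move=> mD mf fM; apply: (@integrableS _ _ _ _ setT) => //.
apply/integrableP; split; first exact/measurable_EFinP.
(* The dominating constant is [|M|], which is visibly nonnegative. *)
apply: (@le_lt_trans _ _ (\int[P]_t `|M|%:E)%E); last first.
  by rewrite integral_cst//= probability_setT mule1 ltry.
apply: ae_ge0_le_integral => //.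
- exact/measurableT_comp/measurable_EFinP.
- apply: filterS fM => t fM _ /=; rewrite lee_fin.
  exact: le_trans fM (ler_norm _).
Qed.

(** * Integrals over a sub-sigma-algebra: pulling out a measurable factor *)

Lemma sub_g_sigma_measurable (d : measure_display) (T : measurableType d)
  (G : set (set T)) : G `<=` measurable -> <<s G >> `<=` measurable.
Proof.
by move=> GT; apply: smallest_sub => //; exact: sigma_algebra_measurable.
Qed.

Lemma g_sigma_measurable_fun (d : measure_display) (T : measurableType d)
  (R : realType) (G : set (set T)) (f : T -> R) : G `<=` measurable ->
  measurable_fun setT (f : g_sigma_algebraType G -> R) -> measurable_fun setT f.
Proof.
by move=> GT mf _ B mB; apply: (sub_g_sigma_measurable _ _ G GT); exact: mf.
Qed.

Section sub_sigma_algebra.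
Context {d : measure_display} {T : measurableType d} {R : realType}.
Variables (P : {measure set T -> \bar R}) (G : set (set T)).
Hypothesis GT : G `<=` measurable.

Import HBNNSimple.

(** Simple functions measurable for [<<s G>>] increase to [c], and monotone convergence applies. The
    gain is that [X] enters the right-hand side only through its integrals over sets of
    [<<s G>>]. *)
Lemma integral_mul_limn_sub_sigma (X : T -> R) (c : g_sigma_algebraType G -> R)
  (mc : measurable_fun setT (EFin \o c)) (A : set T) :
  <<s G >> A -> measurable_fun setT X -> (forall t, 0 <= X t) ->
  (forall t, 0 <= c t) ->
  let f_ := nnsfun_approx measurableT mc in
  (\int[P]_(t in A) (c t * X t)%:E = limn (fun n => \sum_(k \in range (f_ n))
     (k%:E * \int[P]_(t in A `&` f_ n @^-1` [set k]) (X t)%:E)))%E.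
Proof.
move=> GA mX X0 c0 f_.
have mA : measurable A by exact: (sub_g_sigma_measurable _ _ G GT).
have mf n : measurable_fun setT (f_ n : T -> R).
  by apply: (g_sigma_measurable_fun _ _ _ G) => //; exact: measurable_funP.
have mI n k : measurable ((f_ n @^-1` [set k]) : set T).
  by rewrite -[X in measurable X]setTI; apply: mf.
transitivity (limn (fun n => \int[P]_(t in A) (f_ n t * X t)%:E))%E.
  rewrite -monotone_convergence//.
  - apply: eq_integral => t tA; apply/esym/cvg_lim => //=.
    under eq_fun do rewrite EFinM.
    rewrite EFinM; apply: cvgeZr => //.
    by apply: (@cvg_nnsfun_approx _ _ _ _ _ _ mc) => // x _; rewrite lee_fin.
  - by move=> n; apply/measurable_EFinP/measurable_funTS/measurable_funM.
  - by move=> n t _; rewrite lee_fin mulr_ge0.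
  - move=> t _ m n mn; rewrite lee_fin ler_wpM2r//.
    by move/lefP : (nd_nnsfun_approx measurableT mc mn).
congr (limn _); apply/funext => n.
transitivity (\int[P]_(t in A) (\sum_(k \in range (f_ n))
    (k * \1_(f_ n @^-1` [set k]) t * X t)%:E))%E.
  apply: eq_integral => t _; rewrite fimfunE EFinM -fsumEFin//.
  under [RHS]eq_fsbigr do rewrite EFinM.
  rewrite ge0_mule_fsuml//.
  by move=> k; rewrite EFinM; exact: (@nnfun_muleindic_ge0 _ _ _ (f_ n)).
rewrite ge0_integral_fsum//; last 2 first.
- move=> k; apply/measurable_EFinP/measurable_funTS/measurable_funM => //.
  by apply: measurable_funM => //; exact: measurable_indic.
- move=> k t _; rewrite EFinM mule_ge0 ?lee_fin//.
  exact: (@nnfun_muleindic_ge0 _ _ _ (f_ n)).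
apply: eq_fsbigr => k /[!inE] -[t0 _ <-{k}].
under eq_integral do rewrite -mulrA EFinM.
rewrite ge0_integralZl//.
- congr (_ * _)%E; rewrite [RHS]integral_mkcondr/=.
  apply: eq_integral => t _; rewrite patchE indicE.
  by case: ifPn => _; rewrite ?mul1r ?mul0r.
- by apply/measurable_EFinP/measurable_funTS/measurable_funM.
- by move=> t _; rewrite lee_fin mulr_ge0.
- by rewrite lee_fin.
Qed.

(** Equal integrals on [<<s G>>] make the limits given by the previous formula agree term by term.
    Nonnegativity lets [c] be unbounded, as a quotient by [Us - Ls] can be. *)
Lemma eq_integral_mul_sub_sigma (X Y c : T -> R) :
  measurable_fun setT (c : g_sigma_algebraType G -> R) ->
  measurable_fun setT X -> measurable_fun setT Y ->
  (forall t, 0 <= X t) -> (forall t, 0 <= Y t) -> (forall t, 0 <= c t) ->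
  (forall A, <<s G >> A ->
     \int[P]_(t in A) (X t)%:E = \int[P]_(t in A) (Y t)%:E)%E ->
  forall A, <<s G >> A ->
  (\int[P]_(t in A) (c t * X t)%:E = \int[P]_(t in A) (c t * Y t)%:E)%E.
Proof.
move=> mc mX mY X0 Y0 c0 XY A GA.
have mc' : measurable_fun setT (EFin \o (c : g_sigma_algebraType G -> R)).
  exact/measurable_EFinP.
rewrite !(integral_mul_limn_sub_sigma _ c mc')//.
congr (limn _); apply/funext => n; apply: eq_fsbigr => k _; congr (_ * _)%E.
apply: XY.
suff : (measurable : set (set (g_sigma_algebraType G)))
   (A `&` nnsfun_approx measurableT mc' n @^-1` [set k]) by [].
exact: measurableI.
Qed.

End sub_sigma_algebra.

(** Absolute values repair the signs: they alter the functions only on a null set, and [|c|] stays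
    measurable for [<<s G>>], which an arbitrary modification on a null set would not guarantee. *)
Lemma ae_eq_integral_mul_sub_sigma (d : measure_display) (T : measurableType d)
  (R : realType) (P : {measure set T -> \bar R}) (G : set (set T))
  (X Y c : T -> R) :
  G `<=` measurable ->
  measurable_fun setT (c : g_sigma_algebraType G -> R) ->
  measurable_fun setT X -> measurable_fun setT Y ->
  {ae P, forall t, [/\ 0 <= X t, 0 <= Y t & 0 <= c t]} ->
  (forall A, <<s G >> A ->
     \int[P]_(t in A) (X t)%:E = \int[P]_(t in A) (Y t)%:E)%E ->
  forall A, <<s G >> A ->
  (\int[P]_(t in A) (c t * X t)%:E = \int[P]_(t in A) (c t * Y t)%:E)%E.
Proof.
move=> GT mc mX mY ge0 XY A GA.
have mA B : <<s G >> B -> measurable B by apply: sub_g_sigma_measurable.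
have mcT : measurable_fun setT c by exact: (g_sigma_measurable_fun _ _ _ G).
have mabs (f : T -> R) : measurable_fun setT f ->
  measurable_fun setT (fun t => `|f t|) by move=> mf; exact: measurableT_comp.
have eqX B : measurable B ->
    (\int[P]_(t in B) `|X t|%:E = \int[P]_(t in B) (X t)%:E)%E.
  move=> mB; apply: ae_eq_integral_EFin => //; first exact: mabs.
  by apply: filterS ge0 => t [X0 _ _]; rewrite ger0_norm.
have eqY B : measurable B ->
    (\int[P]_(t in B) `|Y t|%:E = \int[P]_(t in B) (Y t)%:E)%E.
  move=> mB; apply: ae_eq_integral_EFin => //; first exact: mabs.
  by apply: filterS ge0 => t [_ Y0 _]; rewrite ger0_norm.
transitivity (\int[P]_(t in A) (`|c t| * `|X t|)%:E)%E.
  apply: ae_eq_integral_EFin; first exact: mA.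
  - exact: measurable_funM.
  - by apply: measurable_funM; exact: mabs.
  - by apply: filterS ge0 => t [X0 _ c0]; rewrite !ger0_norm.
transitivity (\int[P]_(t in A) (`|c t| * `|Y t|)%:E)%E; last first.
  apply: ae_eq_integral_EFin; first exact: mA.
  - by apply: measurable_funM; exact: mabs.
  - exact: measurable_funM.
  - by apply: filterS ge0 => t [_ Y0 c0]; rewrite !ger0_norm.
apply: (@eq_integral_mul_sub_sigma _ _ _ P G GT (fun t => `|X t|)
  (fun t => `|Y t|) (fun t => `|c t|)) => //.
- exact: (measurableT_comp (@normr_measurable R setT) mc).
- exact: mabs.
- exact: mabs.
- by move=> B GB; rewrite eqX ?eqY ?XY//; exact: mA.
Qed.

(** * Uniform law and independence *)

Lemma uniform_prob_itvNyc (R : realType) (y : R) : 0 <= y <= 1 ->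
  uniform_prob (@ltr01 R) `]-oo, y] = y%:E.
Proof.
move=> /andP[y0 y1]; rewrite /uniform_prob integral_uniform_pdf.
rewrite (_ : _ `&` _ = `[0, y]%classic); last first.
  apply/seteqP; split=> x /=; rewrite !in_itv/=.
    by move=> [xy /andP[-> _]].
  by move=> /andP[-> xy]; rewrite xy (le_trans xy y1).
rewrite (eq_integral (fun=> 1%E)).
  rewrite integral_cst//= mul1e lebesgue_measure_itv/= lte_fin.
  (* The length formula branches on [0 < y], so [y = 0] is treated apart. *)
  by move: y0; rewrite le_eqVlt => /predU1P[<-|->]; rewrite ?ltxx// oppr0 adde0.
move=> x; rewrite inE/= in_itv/= => /andP[x0 xy].
by rewrite /uniform_pdf x0 (le_trans xy y1) subr0 invr1.
Qed.

(* By independence the joint law of (id, G0) on the sub-sigma-algebra times R is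
   a product measure, so conditioning on Y = y yields P (G0 <= y) = y. *)
Lemma prob_uniform_le_indep (d : measure_display) (T : measurableType d)
  (R : realType) (P : probability T R) (G : set (set T)) (G0 : {RV P >-> R})
  (Y : T -> R) :
  G `<=` measurable ->
  (forall A : set R, measurable A ->
     P (G0 @^-1` A) = uniform_prob (@ltr01 R) A) ->
  (forall (A : set R) (B : set T), measurable A -> <<s G >> B ->
     P (G0 @^-1` A `&` B) = (P (G0 @^-1` A) * P B)%E) ->
  measurable_fun setT (Y : g_sigma_algebraType G -> R) ->
  {ae P, forall t, 0 <= Y t <= 1} ->
  P [set t | G0 t <= Y t] = (\int[P]_t (Y t)%:E)%E.
Proof.
move=> GT G0U indep mY Y01.
have mYT : measurable_fun setT Y by exact: (g_sigma_measurable_fun _ _ _ G).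
pose TG : measurableType _ := g_sigma_algebraType G.
(* Viewed as a map into [T] with the smaller sigma-algebra, the identity is a random variable whose
   law is the restriction of [P]. *)
have mid : measurable_fun setT (id : T -> TG).
  by move=> _ B mB; rewrite setTI; exact: (sub_g_sigma_measurable _ _ G GT).
pose h (t : T) : TG * measurableTypeR R := (t, G0 t).
have mh : measurable_fun setT h.
  by apply: measurable_fun_pair => //; exact: (measurable_funPT G0).
pose idP := isMeasurableFun.Build _ _ _ _ (id : T -> TG) mid.
pose idM : {mfun T >-> TG} := HB.pack (id : T -> TG) idP.
pose hP := isMeasurableFun.Build _ _ _ _ h mh.
pose hM : {mfun T >-> (TG * measurableTypeR R)%type} := HB.pack h hP.
pose S : set (TG * measurableTypeR R) := [set z | z.2 <= Y z.1].
have mS : measurable S.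
  apply: measurable_set_ler; first exact: measurable_snd.
  exact: (measurableT_comp mY measurable_fst).
have -> : P [set t | G0 t <= Y t] = distribution P hM S by [].
(* Independence makes the joint law agree with the product measure on rectangles, hence everywhere;
   the section of [S] over [t] is []-oo, Y t]]. *)
rewrite -(@product_measure_unique _ _ TG (measurableTypeR R) R
  (distribution P idM) (uniform_prob (@ltr01 R)) (distribution P hM))//; last first.
  move=> A B mA mB; rewrite [RHS]muleC.
  transitivity (P (G0 @^-1` B) * P A)%E; last by rewrite G0U.
  rewrite -indep//.
  by congr (P _); apply/seteqP; split=> t [].
rewrite /product_measure1 ge0_integral_distribution//; last first.
  exact: measurable_fun_xsection.
apply: ae_eq_integral => //.
- apply: (@measurableT_comp _ _ _ _ TG) => //; exact: measurable_fun_xsection.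
- exact/measurable_EFinP.
- apply: filterS Y01 => t Yt _ /=.
  by rewrite -uniform_prob_itvNyc//; congr uniform_prob;
    apply/seteqP; split=> x; rewrite xsectionE/= in_itv.
Qed.

(** * Deterministic analysis of the recursion at a fixed outcome *)

Section pathwise.
Context {d : measure_display} {T : measurableType d} {R : realType}.
Variables (L U Ls Us : nat -> T -> R) (G0 : T -> R) (t : T).
Local Notation tL := (tL L U Ls Us).
Local Notation tU := (tU L U Ls Us).

(** Gathers at one outcome the inequalities that hold almost surely, so that probability enters only
    when they are invoked. *)
Definition ordered_bounds := forall n, (1 <= n)%N ->
  [/\ Ls n t <= L n t, L n t <= U n t, U n t <= Us n t & Ls n t < Us n t].

Hypothesis ob : ordered_bounds.

Lemma tLS n : tL n.+1 t =
  tL n t + (L n.+1 t - Ls n.+1 t) / (Us n.+1 t - Ls n.+1 t) * (tU n t - tL n t).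
Proof. by []. Qed.

Lemma tUS n : tU n.+1 t =
  tU n t - (Us n.+1 t - U n.+1 t) / (Us n.+1 t - Ls n.+1 t) * (tU n t - tL n t).
Proof. by []. Qed.

(** The numerators of the two corrections sum to [(Us - Ls) - (U - L)], so each step rescales the
    width by a nonnegative ratio; this keeps [tL] below [tU]. *)
Lemma widthS n : tU n.+1 t - tL n.+1 t =
  (U n.+1 t - L n.+1 t) / (Us n.+1 t - Ls n.+1 t) * (tU n t - tL n t).
Proof.
have [_ _ _ lt_s] := ob n.+1 isT.
have d0 : Us n.+1 t - Ls n.+1 t != 0 by rewrite subr_eq0 gt_eqF.
by rewrite tLS tUS; field.
Qed.

Lemma width_ge0 n : 0 <= tU n t - tL n t.
Proof.
elim: n => [|n IH]; first by rewrite subr0 ler01.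
have [_ LU _ lt_s] := ob n.+1 isT.
by rewrite widthS mulr_ge0// divr_ge0 ?subr_ge0// ltW.
Qed.

Lemma tL_nondecreasing : {homo tL^~ t : m n / (m <= n)%N >-> m <= n}.
Proof.
apply: homo_leq => [//|x y z|n]; first exact: le_trans.
have [LsL _ _ lt_s] := ob n.+1 isT.
by rewrite tLS lerDl mulr_ge0 ?width_ge0// divr_ge0 ?subr_ge0// ltW.
Qed.

Lemma tU_nonincreasing : {homo tU^~ t : m n / (m <= n)%N >-> n <= m}.
Proof.
apply: homo_leq => [//|x y z xy yz|n]; first exact: le_trans yz xy.
have [_ _ UUs lt_s] := ob n.+1 isT.
by rewrite tUS gerBl mulr_ge0 ?width_ge0// divr_ge0 ?subr_ge0// ltW.
Qed.

Lemma tL_le_tU m n : tL m t <= tU n t.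
Proof.
apply: (le_trans (tL_nondecreasing _ _ (leq_maxl m n))).
apply: le_trans (tU_nonincreasing _ _ (leq_maxr m n)).
by rewrite -subr_ge0 width_ge0.
Qed.

Lemma tL_itv01 n : 0 <= tL n t <= 1.
Proof. by rewrite (tL_nondecreasing 0 n)// (tL_le_tU n 0). Qed.

Lemma tU_itv01 n : 0 <= tU n t <= 1.
Proof. by rewrite (tU_nonincreasing 0 n)// (tL_le_tU 0 n). Qed.

(** The intervals from [tL] to [tU] are nested, so not having stopped at [n] excludes every earlier
    stop. *)
Lemma N_gtP n : (1 <= n)%N ->
  N_gt L U Ls Us G0 n t <-> tL n t < G0 t <= tU n t.
Proof.
move=> n1; split=> [/(_ n n1 (leqnn n))/not_orP[/negP nL /negP nU]|].
  by rewrite ltNge nL leNgt nU.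
move=> /andP[LG GU] m _ mn -[GL|UG].
  by move: (lt_le_trans LG GL); rewrite ltNge tL_nondecreasing.
by move: (lt_le_trans UG GU); rewrite ltNge tU_nonincreasing.
Qed.

Lemma stop_N_eq n : (1 <= n)%N -> stop_cond L U Ls Us G0 n t ->
  exists2 m, N_eq L U Ls Us G0 m t & (m <= n)%N.
Proof.
move=> n1 sn; pose stopped k := (1 <= k)%N && `[< stop_cond L U Ls Us G0 k t >].
have ex_stop : exists k, stopped k.
  by exists n; rewrite /stopped n1; exact/asboolP.
case: (ex_minnP ex_stop) => m /andP[m1 /asboolP sm] m_min; exists m.
  split=> // k k1 km /asboolP sk.
  by move: km; rewrite ltnNge m_min// /stopped k1.
by apply: m_min; rewrite /stopped n1; exact/asboolP.
Qed.

(** Some first stop [m <= n] exists, and it cannot be an upper exit: [tU m < G0] would contradict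
    [G0 <= tL n <= tU m]. *)
Lemma Cs_one_of_le_tL n : (1 <= n)%N -> G0 t <= tL n t ->
  Cs_one L U Ls Us G0 t.
Proof.
move=> n1 GL; have [m mN mn] := stop_N_eq _ n1 (or_introl GL).
exists m; split=> //; have [_ [//|UG] _] := mN.
by move: (le_lt_trans (tL_le_tU n m) UG); rewrite ltNge GL.
Qed.

Lemma Cs_one_le_tU n : Cs_one L U Ls Us G0 t -> G0 t <= tU n t.
Proof. by move=> [m [_ GL]]; exact: le_trans GL (tL_le_tU m n). Qed.

Lemma not_N_finite : ~ N_finite L U Ls Us G0 t ->
  forall n, N_gt L U Ls Us G0 n t.
Proof.
by move=> nN n m m1 _ /(stop_N_eq _ m1)[k kN _]; apply: nN; exists k.
Qed.

End pathwise.

(** * Tail sigma-algebras *)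

Section filtration.
Context {d : measure_display} {T : measurableType d} {R : realType}.
Variables (L U : nat -> T -> R).
Hypothesis mL : forall n, measurable_fun setT (L n).
Hypothesis mU : forall n, measurable_fun setT (U n).

(** The generating family of [Finf L U k], named so that [g_sigma_algebraType] can be applied to
    it. *)
Definition tail_gen k := \bigcup_(j in [set j | (k <= j)%N]) Fn L U j.

Lemma tail_gen_measurable k : tail_gen k `<=` measurable.
Proof.
move=> A [[|n] _]; first by case=> ->.
apply: sub_g_sigma_measurable => {}A [] [B [mB ->]].
  by rewrite -[X in measurable X]setTI; exact: mL.
by rewrite -[X in measurable X]setTI; exact: mU.
Qed.

Lemma Finf_measurable k A : Finf L U k A -> measurable A.
Proof. by apply: sub_g_sigma_measurable; exact: tail_gen_measurable. Qed.

Lemma Finf_nonincreasing m n : (m <= n)%N -> Finf L U n `<=` Finf L U m.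
Proof.
move=> mn; apply: smallest_sub; first exact: smallest_sigma_algebra.
move=> A [j nj FA]; apply: sub_sigma_algebra; exists j => //.
exact: leq_trans mn nj.
Qed.

Lemma G_measurable_Finf m n (f : T -> R) : (m <= n)%N ->
  G_measurable (Finf L U n) f ->
  measurable_fun setT (f : g_sigma_algebraType (tail_gen m) -> R).
Proof.
move=> mn mf _ B mB; rewrite setTI.
by apply: (Finf_nonincreasing m n mn); exact: mf.
Qed.

(** Indices are successors because [Fn] at 0 is the trivial family, not the one generated by [L 0]
    and [U 0]. *)
Lemma L_Finf_measurable m n : (m <= n.+1)%N ->
  measurable_fun setT (L n.+1 : g_sigma_algebraType (tail_gen m) -> R).
Proof.
move=> mn _ B mB; rewrite setTI; apply: sub_sigma_algebra.
by exists n.+1 => //; apply: sub_sigma_algebra; left; exists B.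
Qed.

Lemma U_Finf_measurable m n : (m <= n.+1)%N ->
  measurable_fun setT (U n.+1 : g_sigma_algebraType (tail_gen m) -> R).
Proof.
move=> mn _ B mB; rewrite setTI; apply: sub_sigma_algebra.
by exists n.+1 => //; apply: sub_sigma_algebra; right; exists B.
Qed.

End filtration.

(** * Measurability of the stopping events *)

Section stopping_measurable.
Context {d : measure_display} {T : measurableType d} {R : realType}.
Variables (L U Ls Us : nat -> T -> R) (G0 : T -> R).
Hypothesis mG0 : measurable_fun setT G0.
Hypothesis mtL : forall n, measurable_fun setT (tL L U Ls Us n).
Hypothesis mtU : forall n, measurable_fun setT (tU L U Ls Us n).

Lemma measurable_stop_cond n : measurable [set t | stop_cond L U Ls Us G0 n t].
Proof.
apply: (measurableU [set t | G0 t <= tL L U Ls Us n t]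
                    [set t | tU L U Ls Us n t < G0 t]).
  exact: measurable_set_ler.
rewrite (_ : mkset _ = ~` [set t | G0 t <= tU L U Ls Us n t]).
  by apply: measurableC; exact: measurable_set_ler.
by apply/seteqP; split=> t /=; rewrite ltNge => /negP.
Qed.

Lemma measurable_N_gt n : measurable [set t | N_gt L U Ls Us G0 n t].
Proof.
rewrite (_ : mkset _ = \bigcap_(m in [set m | (1 <= m <= n)%N])
    ~` [set t | stop_cond L U Ls Us G0 m t]).
  apply: bigcap_measurableType => m _.
  by apply: measurableC; exact: measurable_stop_cond.
apply/seteqP; split=> t /= h m; first by move=> /andP[]; exact: h.
by move=> m1 mn; apply: h; rewrite /= m1.
Qed.

Lemma measurable_N_eq n : measurable [set t | N_eq L U Ls Us G0 n t].
Proof.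
case: n => [|n].
  by rewrite (_ : mkset _ = set0)//; apply/seteqP; split=> t // -[].
(* First stopping at [n.+1] means stopping there while still running after step [n]. *)
rewrite (_ : mkset _ = [set t | stop_cond L U Ls Us G0 n.+1 t] `&`
    [set t | N_gt L U Ls Us G0 n t]).
  by apply: measurableI; [exact: measurable_stop_cond|exact: measurable_N_gt].
by apply/seteqP; split=> t [] //= sn h; split.
Qed.

Lemma measurable_Cs_one : measurable [set t | Cs_one L U Ls Us G0 t].
Proof.
rewrite (_ : mkset _ = \bigcup_n ([set t | N_eq L U Ls Us G0 n t] `&`
    [set t | G0 t <= tL L U Ls Us n t])).
  apply: bigcupT_measurable => n; apply: measurableI.
    exact: measurable_N_eq.
  exact: measurable_set_ler.
by apply/seteqP; split=> t; [move=> [n h]; exists n|move=> [n _ h]; exists n].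
Qed.

End stopping_measurable.

(** * Conditional expectations of the monotone bounds given the tail *)

Section reverse_martingale.
Context {d : measure_display} {T : measurableType d} {R : realType}.
Variables (P : probability T R) (L U Ls Us : nat -> T -> R).
Hypothesis mL : forall n, measurable_fun setT (L n).
Hypothesis mU : forall n, measurable_fun setT (U n).
Hypothesis L0 : forall t, L 0%N t = 0.
Hypothesis U0 : forall t, U 0%N t = 1.
Hypothesis L_le1 : forall n, {ae P, forall t, `|L n t| <= 1}.
Hypothesis U_le1 : forall n, {ae P, forall t, `|U n t| <= 1}.
Hypothesis ceL : forall n, is_cond_exp P (Finf L U n.+1) (L n) (Ls n.+1).
Hypothesis ceU : forall n, is_cond_exp P (Finf L U n.+1) (U n) (Us n.+1).
Hypothesis ob : {ae P, forall t, ordered_bounds L U Ls Us t}.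
Local Notation tL := (tL L U Ls Us).
Local Notation tU := (tU L U Ls Us).

(** Places both sequences in the sigma-algebra from which [G0] is independent. The claims are proved
    jointly since each recursion uses both previous values. *)
Lemma tLU_Finf_measurable n :
  measurable_fun setT (tL n : g_sigma_algebraType (tail_gen L U 1) -> R) /\
  measurable_fun setT (tU n : g_sigma_algebraType (tail_gen L U 1) -> R).
Proof.
elim: n => [|n [IHL IHU]].
  by split; [exact: (measurable_cst (0 : R))|exact: (measurable_cst (1 : R))].
have mLn := L_Finf_measurable L U 1 n isT.
have mUn := U_Finf_measurable L U 1 n isT.
have [mLs _ _] := ceL n; have [mUs _ _] := ceU n.
have {}mLs := G_measurable_Finf L U 1 n.+1 _ isT mLs.
have {}mUs := G_measurable_Finf L U 1 n.+1 _ isT mUs.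
have mV := measurable_funV _ _ _ _ _ (measurable_funB mUs mLs).
have mW := measurable_funB IHU IHL.
split.
- apply: (measurable_funD IHL); apply: measurable_funM mW.
  exact: measurable_funM (measurable_funB mLn mLs) mV.
- apply: (measurable_funB IHU); apply: measurable_funM mW.
  exact: measurable_funM (measurable_funB mUs mUn) mV.
Qed.

Lemma tL_Finf_measurable n :
  measurable_fun setT (tL n : g_sigma_algebraType (tail_gen L U 1) -> R).
Proof. by have [] := tLU_Finf_measurable n. Qed.

Lemma tU_Finf_measurable n :
  measurable_fun setT (tU n : g_sigma_algebraType (tail_gen L U 1) -> R).
Proof. by have [] := tLU_Finf_measurable n. Qed.

Let mtL n : measurable_fun setT (tL n).
Proof.
apply: (g_sigma_measurable_fun _ _ _ (tail_gen L U 1)).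
  exact: tail_gen_measurable.
exact: tL_Finf_measurable.
Qed.

Let mtU n : measurable_fun setT (tU n).
Proof.
apply: (g_sigma_measurable_fun _ _ _ (tail_gen L U 1)).
  exact: tail_gen_measurable.
exact: tU_Finf_measurable.
Qed.

Let int_L n A : measurable A -> P.-integrable A (EFin \o L n).
Proof. by move=> mA; exact: ae_bounded_integrable. Qed.

Let int_U n A : measurable A -> P.-integrable A (EFin \o U n).
Proof. by move=> mA; exact: ae_bounded_integrable. Qed.

Lemma tL_integrable n A : measurable A -> P.-integrable A (EFin \o tL n).
Proof.
move=> mA; apply: (ae_bounded_integrable _ _ _ _ _ 1) => //.
apply: filterS ob => t obt.
by have /andP[? ?] := tL_itv01 _ _ _ _ _ obt n; rewrite ger0_norm.
Qed.

Lemma tU_integrable n A : measurable A -> P.-integrable A (EFin \o tU n).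
Proof.
move=> mA; apply: (ae_bounded_integrable _ _ _ _ _ 1) => //.
apply: filterS ob => t obt.
by have /andP[? ?] := tU_itv01 _ _ _ _ _ obt n; rewrite ger0_norm.
Qed.

Let mLs n : measurable_fun setT (Ls n.+1).
Proof. by have [_ /measurable_int/measurable_EFinP ? _] := ceL n. Qed.

Let mUs n : measurable_fun setT (Us n.+1).
Proof. by have [_ /measurable_int/measurable_EFinP ? _] := ceU n. Qed.

Let int_Ls n A : measurable A -> P.-integrable A (EFin \o Ls n.+1).
Proof. by move=> mA; have [_ Li _] := ceL n; exact: integrableS Li. Qed.

Let int_Us n A : measurable A -> P.-integrable A (EFin \o Us n.+1).
Proof. by move=> mA; have [_ Ui _] := ceU n; exact: integrableS Ui. Qed.

Let intB (f g : T -> R) A : measurable A ->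
  P.-integrable A (EFin \o f) -> P.-integrable A (EFin \o g) ->
  (\int[P]_(t in A) (f t - g t)%:E =
   \int[P]_(t in A) (f t)%:E - \int[P]_(t in A) (g t)%:E)%E.
Proof. by move=> mA fi gi; exact: integralB_EFin. Qed.

(** Integrated form of the conditional expectation identities. The sigma-algebras shrink with [n],
    so a set of the next one is covered by the induction hypothesis, and the defining property of
    [Ls n.+1] and [Us n.+1] then applies to it. *)
Lemma integral_tLU n A : Finf L U n A ->
  (\int[P]_(t in A) (tL n t)%:E = \int[P]_(t in A) (L n t)%:E /\
   \int[P]_(t in A) (tU n t)%:E = \int[P]_(t in A) (U n t)%:E)%E.
Proof.
elim: n A => [|n IH] A FA.
  by split; apply: eq_integral => t _; rewrite ?L0 ?U0.
have mF B : Finf L U n.+1 B -> measurable B by exact: Finf_measurable.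
have IHL B : Finf L U n.+1 B ->
    (\int[P]_(t in B) (tL n t)%:E = \int[P]_(t in B) (Ls n.+1 t)%:E)%E.
  move=> FB; have [_ _ ->//] := ceL n.
  by have [] := IH B (Finf_nonincreasing L U n n.+1 (leqnSn n) B FB).
have IHU B : Finf L U n.+1 B ->
    (\int[P]_(t in B) (tU n t)%:E = \int[P]_(t in B) (Us n.+1 t)%:E)%E.
  move=> FB; have [_ _ ->//] := ceU n.
  by have [] := IH B (Finf_nonincreasing L U n n.+1 (leqnSn n) B FB).
have mLn := L_Finf_measurable L U n.+1 n (leqnn _).
have mUn := U_Finf_measurable L U n.+1 n (leqnn _).
have [mLs' _ _] := ceL n; have [mUs' _ _] := ceU n.
have {}mLs' := G_measurable_Finf L U n.+1 n.+1 _ (leqnn _) mLs'.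
have {}mUs' := G_measurable_Finf L U n.+1 n.+1 _ (leqnn _) mUs'.
have mV := measurable_funV _ _ _ _ _ (measurable_funB mUs' mLs').
have mtLU m : measurable_fun setT (fun t => tU m t - tL m t).
  exact: measurable_funB.
(* E(tU_n - tL_n | F_(n+1,oo)) = Us_(n+1) - Ls_(n+1) cancels the denominator. *)
have key (c : T -> R) :
    measurable_fun setT (c : g_sigma_algebraType (tail_gen L U n.+1) -> R) ->
    {ae P, forall t, 0 <= c t} ->
    (\int[P]_(t in A)
       (c t / (Us n.+1 t - Ls n.+1 t) * (tU n t - tL n t))%:E =
     \int[P]_(t in A) (c t)%:E)%E.
  move=> mc c0; have mcV := measurable_funM mc mV.
  have GT := tail_gen_measurable L U mL mU n.+1.
  rewrite (ae_eq_integral_mul_sub_sigma _ _ _ P (tail_gen L U n.+1)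
    (fun t => tU n t - tL n t) (fun t => Us n.+1 t - Ls n.+1 t) _ GT mcV)//.
  - apply: ae_eq_integral_EFin; first exact: mF.
    + apply: measurable_funM; last exact: measurable_funB.
      exact: (g_sigma_measurable_fun _ _ _ _ _ GT mcV).
    + exact: (g_sigma_measurable_fun _ _ _ _ _ GT mc).
    + apply: filterS ob => t /(_ n.+1 isT)[_ _ _ lt_s].
      by rewrite divfK// subr_eq0 gt_eqF.
  - exact: measurable_funB.
  - apply: filterS2 c0 ob => t c0 obt; have [_ _ _ lt_s] := obt n.+1 isT.
    have s0 : 0 <= Us n.+1 t - Ls n.+1 t by rewrite subr_ge0 ltW.
    by split=> //; [exact: width_ge0|rewrite divr_ge0].
  - move=> B FB; have mB := mF B FB.
    rewrite !intB ?IHL ?IHU//; [exact: int_Us|exact: int_Ls| |].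
      exact: tU_integrable.
    exact: tL_integrable.
have mA := mF A FA.
(* The increment of [tL] is the case [c = L - Ls] of [key]; the integrals of [Ls] then cancel. *)
have EtL : (\int[P]_(t in A) (tL n.+1 t)%:E = \int[P]_(t in A) (L n.+1 t)%:E)%E.
  transitivity (\int[P]_(t in A) (tL n t)%:E +
                \int[P]_(t in A) (tL n.+1 t - tL n t)%:E)%E.
    rewrite intB//; [|exact: tL_integrable|exact: tL_integrable].
    rewrite addeC subeK//; apply: integrable_fin_num => //.
    exact: tL_integrable.
  under [X in (_ + X)%E]eq_integral do rewrite tLS addrAC subrr add0r.
  rewrite (key (fun t => L n.+1 t - Ls n.+1 t)) ?IHL//; last 2 first.
  - exact: measurable_funB.
  - by apply: filterS ob => t /(_ n.+1 isT)[LsL _ _ _]; rewrite subr_ge0.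
  rewrite intB//; [|exact: int_L|exact: int_Ls].
  rewrite addeC subeK//; apply: integrable_fin_num => //; exact: int_Ls.
split=> //.
(* The upper bound is reached through the width: [key] with [c = U - L] gives its integral, and
   adding back the finite integral of [tL] finishes. *)
have EW : (\int[P]_(t in A) (tU n.+1 t - tL n.+1 t)%:E =
           \int[P]_(t in A) (U n.+1 t - L n.+1 t)%:E)%E.
  rewrite -(key (fun t => U n.+1 t - L n.+1 t)); last 2 first.
  - exact: measurable_funB.
  - by apply: filterS ob => t /(_ n.+1 isT)[_ LU _ _]; rewrite subr_ge0.
  apply: ae_eq_integral_EFin => //.
    apply: measurable_funM => //; apply: measurable_funM.
      exact: measurable_funB.
    by apply: measurable_funV; exact: measurable_funB.
  by apply: filterS ob => t obt; rewrite widthS.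
have tLfin : (\int[P]_(t in A) (tL n.+1 t)%:E)%E \is a fin_num.
  by apply: integrable_fin_num => //; exact: tL_integrable.
move: EW; rewrite (intB _ _ _ mA (tU_integrable _ _ mA) (tL_integrable _ _ mA)).
rewrite (intB _ _ _ mA (int_U _ _ mA) (int_L _ _ mA)).
by rewrite -EtL => /(congr1 (fun x => (x + \int[P]_(t in A) (tL n.+1 t)%:E)%E));
  rewrite !subeK.
Qed.

(** The whole space belongs to every tail sigma-algebra. *)
Lemma expectation_tL n : ('E_P[tL n] = 'E_P[L n])%E.
Proof.
rewrite !unlock.
by have [] := integral_tLU n _
  (@measurableT _ (g_sigma_algebraType (tail_gen L U n))).
Qed.

Lemma expectation_tU n : ('E_P[tU n] = 'E_P[U n])%E.
Proof.
rewrite !unlock.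
by have [] := integral_tLU n _
  (@measurableT _ (g_sigma_algebraType (tail_gen L U n))).
Qed.

End reverse_martingale.

(** * Law of the running time and of the output *)

Theorem theorem1 (d : measure_display) (T : measurableType d) (R : realType)
  (P : probability T R) (s : R) (L U : nat -> {RV P >-> R})
  (Ls Us : nat -> T -> R) (G0 : {RV P >-> R}) :
  0 <= s <= 1 ->
  (forall t, L 0%N t = 0) -> (forall t, U 0%N t = 1) ->
  {ae P, forall t, forall n, (1 <= n)%N ->
     [/\ L n t <= U n t, 0 <= L n t <= 1 & 0 <= U n t <= 1]} ->
  (forall n, (1 <= n)%N -> ('E_P[L n] <= 'E_P[L n.+1])%E) ->
  ('E_P[L n] @[n --> \oo] --> s%:E)%E ->
  (forall n, (1 <= n)%N -> ('E_P[U n.+1] <= 'E_P[U n])%E) ->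
  ('E_P[U n] @[n --> \oo] --> s%:E)%E ->
  (forall n, (1 <= n)%N ->
     [/\ is_cond_exp P (Fn (fun k => L k) (fun k => U k) n) (L n.-1) (Ls n),
         is_cond_exp P (Finf (fun k => L k) (fun k => U k) n) (L n.-1) (Ls n),
         is_cond_exp P (Fn (fun k => L k) (fun k => U k) n) (U n.-1) (Us n) &
         is_cond_exp P (Finf (fun k => L k) (fun k => U k) n) (U n.-1) (Us n)]) ->
  (forall n, (1 <= n)%N -> {ae P, forall t, Ls n t <= L n t}) ->
  (forall n, (1 <= n)%N -> {ae P, forall t, U n t <= Us n t}) ->
  (forall n, (1 <= n)%N -> {ae P, forall t, Ls n t < Us n t}) ->
  (* G0 ~ U(0,1) *)
  (forall A : set R, measurable A -> P (G0 @^-1` A) = uniform_prob (@ltr01 R) A) ->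
  (* G0 independent of (L_n, U_n)_{n >= 1} *)
  (forall (A : set R) (B : set T), measurable A ->
     Finf (fun k => L k) (fun k => U k) 1 B ->
     P (G0 @^-1` A `&` B) = (P (G0 @^-1` A) * P B)%E) ->
  let Lf := fun k => (L k : T -> R) in
  let Uf := fun k => (U k : T -> R) in
  [/\ {ae P, forall t, N_finite Lf Uf Ls Us G0 t},
      P [set t | Cs_one Lf Uf Ls Us G0 t] = s%:E &
      forall n, (1 <= n)%N ->
        P [set t | N_gt Lf Uf Ls Us G0 n t] = ('E_P[U n] - 'E_P[L n])%E].
Proof.
move=> s01 L0 U0 LU01 _ El _ Eu ce LsL UUs LsUs G0U indep Lf Uf.
have mLf n : measurable_fun setT (Lf n) by exact: measurable_funPT.
have mUf n : measurable_fun setT (Uf n) by exact: measurable_funPT.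
have ob : {ae P, forall t, ordered_bounds Lf Uf Ls Us t}.
  (* Countably many null sets are merged so that all inequalities hold at once, for every index. *)
  have LsL' : {ae P, forall t n, Ls n.+1 t <= L n.+1 t}.
    by apply: ae_foralln => n; exact: LsL.
  have UUs' : {ae P, forall t n, U n.+1 t <= Us n.+1 t}.
    by apply: ae_foralln => n; exact: UUs.
  have LsUs' : {ae P, forall t n, Ls n.+1 t < Us n.+1 t}.
    by apply: ae_foralln => n; exact: LsUs.
  apply: filterS2 LU01 (filterI LsL' (filterI UUs' LsUs')).
  move=> t LU [h1 [h2 h3]] [//|n] _.
  have [LUt _ _] := LU n.+1 isT.
  by split; [exact: h1|exact: LUt|exact: h2|exact: h3].
have L_le1 n : {ae P, forall t, `|Lf n t| <= 1}.
  apply: filterS LU01 => t LU; case: n => [|n].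
    by rewrite /Lf L0 normr0 ler01.
  by have [_ /andP[? ?] _] := LU n.+1 isT; rewrite ger0_norm.
have U_le1 n : {ae P, forall t, `|Uf n t| <= 1}.
  apply: filterS LU01 => t LU; case: n => [|n].
    by rewrite /Uf U0 normr1.
  by have [_ _ /andP[? ?]] := LU n.+1 isT; rewrite ger0_norm.
have ceL n : is_cond_exp P (Finf Lf Uf n.+1) (Lf n) (Ls n.+1).
  by have [] := ce n.+1 isT.
have ceU n : is_cond_exp P (Finf Lf Uf n.+1) (Uf n) (Us n.+1).
  by have [] := ce n.+1 isT.
pose G := tail_gen Lf Uf 1.
have GT : G `<=` measurable by exact: tail_gen_measurable.
have mtL := tL_Finf_measurable P Lf Uf Ls Us ceL ceU.
have mtU := tU_Finf_measurable P Lf Uf Ls Us ceL ceU.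
have mtLT n := g_sigma_measurable_fun _ _ _ G _ GT (mtL n).
have mtUT n := g_sigma_measurable_fun _ _ _ G _ GT (mtU n).
have PtL n : P [set t | G0 t <= tL Lf Uf Ls Us n t] = 'E_P[L n]%E.
  rewrite (prob_uniform_le_indep _ _ _ P G G0 _ GT G0U indep (mtL n)).
    rewrite -(expectation_tL P Lf Uf Ls Us) ?unlock//.
  by apply: filterS ob => t obt; exact: tL_itv01.
have PtU n : P [set t | G0 t <= tU Lf Uf Ls Us n t] = 'E_P[U n]%E.
  rewrite (prob_uniform_le_indep _ _ _ P G G0 _ GT G0U indep (mtU n)).
    rewrite -(expectation_tU P Lf Uf Ls Us) ?unlock//.
  by apply: filterS ob => t obt; exact: tU_itv01.
have mGL n : measurable [set t | G0 t <= tL Lf Uf Ls Us n t].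
  by apply: measurable_set_ler => //; exact: measurable_funPT.
have mGU n : measurable [set t | G0 t <= tU Lf Uf Ls Us n t].
  by apply: measurable_set_ler => //; exact: measurable_funPT.
have mG0 : measurable_fun setT G0 by exact: measurable_funPT.
have mN n : measurable [set t | N_gt Lf Uf Ls Us G0 n t].
  exact: measurable_N_gt.
have PN n : (1 <= n)%N ->
    P [set t | N_gt Lf Uf Ls Us G0 n t] = ('E_P[U n] - 'E_P[L n])%E.
  move=> n1; rewrite -PtL -PtU.
  have PLfin : P [set t | G0 t <= tL Lf Uf Ls Us n t] \is a fin_num.
    exact: fin_num_measure.
  (* Up to a null set, {G0 <= tU_n} is the disjoint union of {N > n} and {G0 <= tL_n}; finiteness of
     the last probability permits the subtraction. *)
  suff -> : P [set t | G0 t <= tU Lf Uf Ls Us n t] =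
      (P [set t | N_gt Lf Uf Ls Us G0 n t] +
       P [set t | (G0 t <= tL Lf Uf Ls Us n t)%R])%E by rewrite addeK.
  rewrite -measureU//; last first.
    apply/seteqP; split=> // t [/(_ n n1 (leqnn n)) nstop GL].
    by apply: nstop; left.
  have eqU : {ae P, forall t, G0 t <= tU Lf Uf Ls Us n t <->
      N_gt Lf Uf Ls Us G0 n t \/ G0 t <= tL Lf Uf Ls Us n t}.
    apply: filterS ob => t obt; rewrite N_gtP//; split.
      by move=> GU; case: (leP (G0 t) (tL Lf Uf Ls Us n t)); [right|left].
    by case=> [/andP[]//|GL]; exact: le_trans GL (tL_le_tU _ _ _ _ _ obt n n).
  apply/eqP; rewrite eq_le; apply/andP; split; apply: le_measure_ae => //.
  - exact: measurableU.
  - by apply: filterS eqU => t [].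
  - exact: measurableU.
  - by apply: filterS eqU => t [].
have Euv : ('E_P[U n] - 'E_P[L n])%E @[n --> \oo] --> 0%E.
  by rewrite -(@subee _ s%:E)//; apply: cvgeB => //.
have mCs : measurable [set t | Cs_one Lf Uf Ls Us G0 t].
  exact: measurable_Cs_one.
split=> //.
(* [A] contains the outcomes that never stop, and its probability is at most u_n - l_n for every n
   >= 1, a bound tending to s - s = 0. *)
- pose A := \bigcap_n [set t | N_gt Lf Uf Ls Us G0 n t].
  exists A; split.
  + exact: bigcapT_measurable.
  + apply/eqP; rewrite eq_le measure_ge0 andbT.
    apply: (cvge_to_ge Euv); exists 1%N => // n n1.
    rewrite -PN//; apply: le_measure; rewrite ?inE//.
      exact: bigcapT_measurable.
    by move=> t; exact.
  + by move=> t nN n _; exact: not_N_finite.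
(* Squeeze: l_n <= P(C_s = 1) <= u_n for n >= 1, and both ends tend to s. *)
- apply/eqP; rewrite eq_le; apply/andP; split.
    apply: (cvge_to_ge Eu); exists 1%N => // n n1; rewrite -PtU.
    apply: le_measure_ae => //; apply: filterS ob => t obt.
    exact: Cs_one_le_tU.
  apply: (cvge_to_le El); exists 1%N => // n n1; rewrite -PtL.
  apply: le_measure_ae => //; apply: filterS ob => t obt.
  exact: Cs_one_of_le_tL.
Qed.
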